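(* Let $\phi : \mathbb{R} \to \mathbb{R}$ be a convex increasing function, let $c \leq d$ be real numbers, and let $a, b \in [c,d]$ be such that $a+b < c+d$. Then $$\phi(a)+\phi(b) \leq \phi(c)+\phi(d).$$
   Context: A function $\phi : \mathbb{R} \to \mathbb{R}$ is convex if $\phi(\lambda x + (1-\lambda) y) \leq \lambda \phi(x) + (1-\lambda)\phi(y)$ for all $x,y \in \mathbb{R}$ and $0 \leq \lambda \leq 1$. Increasing means that $x \leq y$ implies $\phi(x) \leq \phi(y)$. *)

(* Defs.v *)
From mathcomp Require Export all_boot all_order all_algebra.
From mathcomp Require Export classical_sets reals convex.

(* Main.v *)
Require Import Defs.
From mathcomp Require Import all_boot all_order all_algebra.
From mathcomp Require Import classical_sets reals convex.
From mathcomp Require Import interval_inference lra.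
Import Order.TTheory GRing.Theory Num.Theory.
Local Open Scope classical_set_scope.
Local Open Scope ring_scope.

(** Write [a = t c + (1 - t) d].  Its reflection [c + d - a = (1 - t) c + t d]
    has the complementary weights, so adding the two convexity inequalities
    gives [phi a + phi (c + d - a) <= phi c + phi d]; and [b < c + d - a], so
    monotonicity bounds [phi b] by [phi (c + d - a)]. *)

(** Trades the weight packed with its bounds for a plain scalar; over [R^o] scaling is
    multiplication, so the two forms are convertible. *)
Lemma convex_functionT_le (R : realFieldType) (phi : R -> R) (t x y : R) :
  @convex_function R R^o setT phi -> 0 <= t -> t <= 1 ->
  phi (t * x + (1 - t) * y) <= t * phi x + (1 - t) * phi y.
Proof.
move=> phi_convex t0 t1.
exact: (phi_convex (Itv01 t0 t1) x y (in_setT _) (in_setT _)).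
Qed.

Lemma convex_function_reflect_le (R : realFieldType) (phi : R -> R)
    (c d a : R) :
  @convex_function R R^o setT phi -> a \in `[c, d] ->
  phi a + phi (c + d - a) <= phi c + phi d.
Proof.
move=> phi_convex; rewrite in_itv /= => /andP[ca ad].
(* The weight [t] divides by [d - c], so a one-point interval is treated apart. *)
have [ltcd|ledc] := ltP c d; last first.
  have -> : a = c by apply: le_anti; rewrite ca (le_trans ad ledc).
  by rewrite addrAC subrr add0r.
have dc0 : 0 < d - c by rewrite subr_gt0.
pose t := (d - a) / (d - c).
have t0 : 0 <= t by rewrite divr_ge0 ?subr_ge0 // ltW.
have t1 : t <= 1 by rewrite ler_pdivrMr // mul1r lerD2l lerN2.
(* With the division cleared, [aE] and [rE] are linear in the products [t * c] and [t * d], within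
   reach of [lra]. *)
have tE : t * (d - c) = d - a by rewrite divfK ?gt_eqF.
have aE : a = t * c + (1 - t) * d by lra.
have rE : c + d - a = t * d + (1 - t) * c by lra.
have := lerD (convex_functionT_le _ _ _ c d phi_convex t0 t1)
             (convex_functionT_le _ _ _ d c phi_convex t0 t1).
rewrite -aE -rE; lra.
Qed.

Theorem theorem3p4 (R : realType) (phi : R -> R)
    (phi_convex : @convex_function R R^o setT phi)
    (phi_incr : {homo phi : x y / x <= y})
    (c d : R) (le_cd : c <= d)
    (a b : R) (a_cd : a \in `[c, d]) (b_cd : b \in `[c, d])
    (lt_ab_cd : a + b < c + d) :
  phi a + phi b <= phi c + phi d.
Proof.
apply: le_trans (convex_function_reflect_le _ _ _ _ _ phi_convex a_cd).
by rewrite lerD2l phi_incr // lerBrDl ltW.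
Qed.
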